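(* Let $n\in\mathbb{N}$. Let $\{x_{k,n+1}\}_{k=1}^{n+1}$ denote the zeros, in ascending order, of the monic Meixner polynomial $M_{n+1}(x;t+1,w)$, and define $$E_{n,t,w}:=-t+\frac{w(n+1)}{1-w}.$$ Then, for any $t>0$ and $0<w<1$, we have $x_{n+1,n+1}>E_{n,t,w}$ and $$(x-E_{n,t,w})\,M_n(x;t,w)\prec M_{n+1}(x;t+1,w).$$ In particular, $M_{n+1}(x;t+1,w)\prec M_n(x;t,w)$ if and only if $x_{1,n+1}>E_{n,t,w}$.
   Context: Monic Meixner polynomials: for $t>0$, $0<w<1$, $$M_n(x;t,w)=\frac{(t)_n\,w^n}{(w-1)^n}\,{}_2F_1\!\left(-n,-x;t;1-\tfrac1w\right),$$ where $(t)_n=t(t+1)\cdots(t+n-1)$. They are monic of degree $n$ and orthogonal on $\{0,1,2,\dots\}$ with respect to the weight $(t)_x w^x/x!$. Notation $\prec$ for real polynomials $f,g$ with real and distinct zeros: - If $\deg f=\deg g=m$, with zeros $x_1<\dots<x_m$ of $f$ and $y_1<\dots<y_m$ of $g$, then $f\prec g$ means $x_1<y_1<x_2<\cdots<x_m<y_m$. - If $\deg f=m$ and $\deg g=m-1$, with zeros $x_1<\dots<x_m$ of $f$ and $y_1<\dots<y_{m-1}$ of $g$, then $f\prec g$ means $x_1<y_1<x_2<\cdots<y_{m-1}<x_m$. In particular, $f\prec g$ includes the assertion that the zeros of $f$ and of $g$ are real and distinct.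
   Formalization: The interlacing of (x−E)M_n(x;t,w) with M_{n+1}(x;t+1,w) is stated only when M_n(E;t,w) ≠ 0; otherwise (x−E)M_n has a double zero at E and the claim fails (e.g. n=1, t=1, w=1/2, where E=1 and M_1=x−1). *)

(* Defs.v *)
From mathcomp Require Import all_boot all_order all_algebra.
From mathcomp Require Import reals.

Set Implicit Arguments.
Unset Strict Implicit.
Unset Printing Implicit Defensive.

Import Order.TTheory GRing.Theory Num.Theory.
Local Open Scope ring_scope.

(* Rising factorial (a)_k, over any commutative ring, so that (-x)_k is also
   available as a polynomial in x. *)
Definition poch (A : comNzRingType) (a : A) (k : nat) : A :=
  \prod_(j < k) (a + j%:R).

(* 2F1(-n, b; c; z): the series stops at k = n because (-n)_k = 0 for k > n. *)
Definition hyp2F1_negn (F : fieldType) (n : nat) (b c z : F) : F :=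
  \sum_(k < n.+1) poch (- n%:R) k * poch b k / (poch c k * k`!%:R) * z ^+ k.

Definition meixner (F : fieldType) (n : nat) (t w : F) : {poly F} :=
  (poch t n * w ^+ n / (w - 1) ^+ n) *:
  \sum_(k < n.+1)
    (poch (- n%:R) k / (poch t k * k`!%:R) * (1 - w^-1) ^+ k) *: poch (- 'X) k.

Lemma meixnerE (F : fieldType) (n : nat) (t w x : F) :
  (meixner n t w).[x] =
  poch t n * w ^+ n / (w - 1) ^+ n * hyp2F1_negn n (- x) t (1 - w^-1).
Proof.
rewrite hornerZ horner_sum; congr (_ * _); apply: eq_bigr => k _.
rewrite hornerZ horner_prod.
under eq_bigr => j _ do rewrite hornerD hornerN hornerX -polyC_natr hornerC.
by rewrite -/(poch (- x) k) mulrAC (mulrAC (poch (- n%:R) k)).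
Qed.

(* s lists the zeros of p in strictly increasing order. The size condition says
   deg p = size s, so all zeros of p are real and simple. *)
Definition zeros_of (R : realType) (p : {poly R}) (s : seq R) : Prop :=
  [/\ size p = (size s).+1, sorted <%R s & forall x, root p x = (x \in s)].

(* Both degree cases, deg f = deg g and deg f = deg g + 1, require exactly
   x_i < y_i for every y_i and y_i < x_(i+1) for every x_(i+1). *)
Definition interlaces (R : realType) (f g : {poly R}) : Prop :=
  exists xs ys : seq R,
    [/\ zeros_of f xs, zeros_of g ys,
        size xs = size ys \/ size xs = (size ys).+1,
        forall i, (i < size ys)%N -> xs`_i < ys`_i
      & forall i, (i.+1 < size xs)%N -> ys`_i < xs`_i.+1].

Definition meixner_E (R : realType) (n : nat) (t w : R) : R :=
  - t + w * n.+1%:R / (1 - w).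

(* Main.v *)
Require Import Defs.
From mathcomp Require Import all_boot all_order all_algebra.
From mathcomp Require Import reals polyrcf ring lra zify.

(* Write P = M_n(.; t), p = M_n(.; t + 1), Q = M_{n+1}(.; t + 1) and
   E = E_{n,t,w}. In the basis of falling factorials the coefficients give
     M_{n+1}(.; t) = M_{n+1}(.; t + 1) + a M_n(.; t + 1)   with a > 0,
     Q = (x - E) p - d P                                   with d > 0.
   Together they yield a three-term recurrence for the family of parameter
   t + 1, so Q and p interlace; the first identity then shows that P and p do.
   By the second, Q has the sign of (y - E) p(y) at a zero y of P and that of
   - P(E) at E, so Q alternates along the zeros of (x - E) P when E is not a
   zero of P. If E is a zero of P, it lies below the largest zero of p, hence
   below that of Q. *)

Set Implicit Arguments.
Unset Strict Implicit.
Unset Printing Implicit Defensive.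

Import Order.TTheory GRing.Theory Num.Theory.
Local Open Scope ring_scope.

(** * Rising and falling factorials, and the expansion of the Meixner polynomials *)

Lemma pochSr (A : comNzRingType) (a : A) k : poch a k.+1 = poch a k * (a + k%:R).
Proof. by rewrite /poch big_ord_recr. Qed.

Lemma pochSl (A : comNzRingType) (a : A) k : poch a k.+1 = a * poch (a + 1) k.
Proof.
rewrite /poch big_ord_recl addr0; congr (_ * _).
by apply: eq_bigr => j _; rewrite -addrA -natr1 [1 + _]addrC.
Qed.

Lemma pochD (A : comNzRingType) (a : A) k m :
  poch a (k + m) = poch a k * poch (a + k%:R) m.
Proof.
elim: m => [|m IHm]; first by rewrite addn0 /poch big_ord0 mulr1.
by rewrite addnS !pochSr IHm natrD; ring.
Qed.

Lemma poch_gt0 (R : realType) (a : R) k : 0 < a -> 0 < poch a k.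
Proof. by move=> a_gt0; apply: prodr_gt0 => j _; rewrite ltr_wpDr. Qed.

Lemma poch_negn (F : comNzRingType) n k :
  poch (- n%:R : F) k = (-1) ^+ k * (k`! * 'C(n, k))%:R.
Proof.
rewrite mulnC bin_ffact; elim: k => [|k IHk].
  by rewrite /poch big_ord0 ffactn0 mulr1.
rewrite pochSr IHk ffactnSr; case: (leqP k n) => [le_kn|lt_nk].
  by rewrite natrM natrB // exprS; ring.
by rewrite ffact_small // mul0n mulr0 mul0r mulr0.
Qed.

(** Up to sign this is the (-x)_k of the hypergeometric sum, and multiplication by x has only two
    terms in this basis. *)
Definition falling_poly (R : nzRingType) (k : nat) : {poly R} :=
  \prod_(j < k) ('X - j%:R%:P).

Lemma falling_polyS (R : comNzRingType) k :
  'X * falling_poly R k = falling_poly R k.+1 + k%:R *: falling_poly R k.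
Proof.
by rewrite /falling_poly big_ord_recr /= -mul_polyC; ring.
Qed.

Lemma poch_negX (R : comNzRingType) k :
  poch (- 'X : {poly R}) k = (-1) ^+ k * falling_poly R k.
Proof.
elim: k => [|k IHk]; first by rewrite /poch /falling_poly !big_ord0 mulr1.
rewrite pochSr IHk /falling_poly big_ord_recr /= polyC_natr exprS; ring.
Qed.

(* The coefficients of M_n(.; t, w) on the falling factorials, for
   u = w / (w - 1). *)
Definition meixner_coef (R : realType) (n : nat) (t u : R) (k : nat) : R :=
  'C(n, k)%:R * poch (t + k%:R) (n - k) * u ^+ (n - k).

(** The signs of (-n)_k and (-x)_k cancel, (t)_n / (t)_k = (t+k)_{n-k}, and 1 - 1/w = (w-1)/w lowers
    the power of u from n to n - k. *)
Lemma meixner_falling (R : realType) (n : nat) (t w : R) :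
  0 < t -> 0 < w -> w < 1 ->
  meixner n t w =
  \sum_(k < n.+1) meixner_coef n t (w / (w - 1)) k *: falling_poly R k.
Proof.
move=> t_gt0 w_gt0 w_lt1; rewrite /meixner scaler_sumr.
apply: eq_bigr => -[k /= le_kn] _.
have -> : poch (- 'X) k = (-1) ^+ k *: falling_poly R k.
  by rewrite poch_negX -mul_polyC rmorphXn rmorphN1.
rewrite !scalerA.
congr (_ *: _); rewrite ltnS in le_kn.
rewrite poch_negn /meixner_coef.
rewrite -{1 2 3}(subnK le_kn) addnC pochD !exprD.
have wN0 : w != 0 by lra.
have w1N0 : w - 1 != 0 by lra.
have := poch_gt0 k t_gt0 => /lt0r_neq0 pN0.
have fN0 : k`!%:R != 0 :> R by rewrite pnatr_eq0 -lt0n fact_gt0.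
have -> : 1 - w^-1 = (w - 1) / w by field.
rewrite !expr_div_n natrM.
have e1 : (-1) ^+ k * (-1) ^+ k = 1 :> R by rewrite -exprMn mulrNN mulr1 expr1n.
have ek : (w - 1) ^+ k != 0 by rewrite expf_neq0.
have ek' : w ^+ k != 0 by rewrite expf_neq0.
have em : (w - 1) ^+ (n - k) != 0 by rewrite expf_neq0.
transitivity (((-1) ^+ k * (-1) ^+ k) *
  ('C(n, k)%:R * poch (t + k%:R) (n - k) * (w ^+ (n - k) / (w - 1) ^+ (n - k)))).
  by field; rewrite ?pN0 ?fN0 ?ek ?ek' ?em.
by rewrite e1 mul1r.
Qed.

(** * Relations between the parameters t and t + 1 *)

(** For k <= n the two Pochhammer symbols of length n + 1 - k share the factor (t+1+k)_{n-k}; the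
    cofactors differ by n + 1 - k, and (n+1-k) C(n+1, k) = (n+1) C(n, k). *)
Lemma meixner_coef_contiguous (R : realType) (n : nat) (t u : R) k :
  meixner_coef n.+1 t u k =
  meixner_coef n.+1 (t + 1) u k - n.+1%:R * u * meixner_coef n (t + 1) u k.
Proof.
rewrite /meixner_coef; case: (ltngtP k n.+1) => [|lt_nk|->].
- rewrite ltnS => le_kn; have eb := mul_bin_left n.+1 k.
  have {}eb : 'C(n.+1, k)%:R * (n - k).+1%:R = n.+1%:R * 'C(n, k)%:R :> R.
    rewrite -!natrM; congr _%:R.
    by rewrite -(subSn le_kn) [RHS]mul_bin_down mulnC.
  rewrite subSn // pochSl pochSr exprS addrAC.
  have en : (n - k).+1%:R = n%:R - k%:R + 1 :> R by rewrite -natr1 natrB.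
  rewrite en in eb; rewrite natrB //.
  set T := poch _ _; set U := u ^+ _.
  transitivity (('C(n.+1, k)%:R * (t + n%:R + 1)
    - 'C(n.+1, k)%:R * (n%:R - k%:R + 1)) * T * u * U).
    ring.
  by rewrite eb; ring.
- by rewrite !bin_small // 1?ltnW //; ring.
- by rewrite subnn binn bin_small // /poch !big_ord0; ring.
Qed.

(** Coefficient form of Q = (x - E) p - d P: here t + u (n+1) = -E and (n+t) (1-u) = d, while x
    contributes the shifted coefficient and the factor k. *)
Lemma meixner_coef_rec (R : realType) (n : nat) (t u : R) k :
  meixner_coef n.+1 (t + 1) u k =
  (if k is j.+1 then meixner_coef n (t + 1) u j else 0)
  + (k%:R + t + u * n.+1%:R) * meixner_coef n (t + 1) u k
  - (n%:R + t) * (1 - u) * meixner_coef n t u k.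
Proof.
rewrite /meixner_coef; case: (ltngtP k n.+1) => [|lt_nk|->].
- rewrite ltnS => le_kn.
  have eb : 'C(n.+1, k)%:R * (n%:R - k%:R + 1) = n.+1%:R * 'C(n, k)%:R :> R.
    rewrite -natrB // natr1 -!natrM; congr _%:R.
    by rewrite -(subSn le_kn) [RHS]mul_bin_down mulnC.
  have eT : (n%:R + t) * poch (t + k%:R) (n - k) =
            (k%:R + t) * poch (t + 1 + k%:R) (n - k).
    by rewrite [t + 1 + _]addrAC [k%:R + t]addrC -pochSl pochSr natrB //; ring.
  set c := (X in X + _ - _).
  (* Pascal's rule gives C(n, k-1) = C(n+1, k) - C(n, k); at k = 0 both sides are 0. *)
  have -> : c = ('C(n.+1, k)%:R - 'C(n, k)%:R) *
      ((k%:R + t) * poch (t + 1 + k%:R) (n - k)) * (u * u ^+ (n - k)).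
    rewrite -eT -exprS {}/c; case: k le_kn {eb eT} => [|j] le_kn.
      by rewrite !bin0 subrr !mul0r.
    have -> : t + 1 + j%:R = t + j.+1%:R by rewrite -natr1; ring.
    rewrite -(subnSK le_kn) pochSr binS natrD natrB //; ring.
  rewrite subSn // pochSr exprS natrB //.
  move: eT eb; set P := poch _ _; set T := poch _ _; set U := u ^+ _ => eT eb.
  transitivity (('C(n.+1, k)%:R * (k%:R + t)
    + 'C(n.+1, k)%:R * (n%:R - k%:R + 1)) * T * u * U).
    ring.
  (* The last summand vanishes by [eT]; with it, the comparison with the right-hand side is a ring
     identity. *)
  rewrite eb; transitivity ('C(n.+1, k)%:R * (k%:R + t) * T * u * U
    + n.+1%:R * 'C(n, k)%:R * T * u * U
    + (1 - u) * 'C(n, k)%:R * U * ((k%:R + t) * T - (n%:R + t) * P)); last ring.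
  by rewrite eT; ring.
- case: k lt_nk => // k lt_nk.
  by rewrite !bin_small // ?(ltnW lt_nk) //; ring.
- by rewrite !subnn !binn bin_small // /poch !big_ord0; ring.
Qed.

Lemma meixner_contiguous (R : realType) (n : nat) (t w : R) :
  0 < t -> 0 < w -> w < 1 ->
  meixner n.+1 t w =
  meixner n.+1 (t + 1) w + (n.+1%:R * (w / (1 - w))) *: meixner n (t + 1) w.
Proof.
move=> t_gt0 w_gt0 w_lt1; have t1_gt0 : 0 < t + 1 by lra.
rewrite !meixner_falling //.
under eq_bigr do rewrite meixner_coef_contiguous scalerBl.
rewrite sumrB; congr (_ + _).
rewrite big_ord_recr /= {2}/meixner_coef bin_small // !mul0r mulr0 scale0r addr0.
rewrite scaler_sumr -sumrN; apply: eq_bigr => k _.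
rewrite -scaleNr scalerA; congr (_ *: _); field.
by have [-> ->] : w - 1 != 0 /\ 1 - w != 0 by split; lra.
Qed.

Lemma meixner_shift_rec (R : realType) (n : nat) (t w : R) :
  0 < t -> 0 < w -> w < 1 ->
  meixner n.+1 (t + 1) w =
  ('X - (meixner_E n t w)%:P) * meixner n (t + 1) w
  - ((n%:R + t) / (1 - w)) *: meixner n t w.
Proof.
move=> t_gt0 w_gt0 w_lt1; have t1_gt0 : 0 < t + 1 by lra.
rewrite !meixner_falling //; set u := w / (w - 1).
have w1N0 : w - 1 != 0 by lra.
have w1N0' : 1 - w != 0 by lra.
have -> : (n%:R + t) / (1 - w) = (n%:R + t) * (1 - u).
  by rewrite /u; field; rewrite w1N0.
have -> : meixner_E n t w = - t - u * n.+1%:R.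
  by rewrite /u /meixner_E; field; rewrite w1N0.
(* The added top term has C(n, n+1) = 0, so all sums run over the same range. *)
have widen s : \sum_(k < n.+1) meixner_coef n s u k *: falling_poly R k =
               \sum_(k < n.+2) meixner_coef n s u k *: falling_poly R k.
  rewrite [RHS]big_ord_recr /= {3}/meixner_coef bin_small //.
  by rewrite !mul0r scale0r addr0.
have mulX :
    'X * (\sum_(k < n.+1) meixner_coef n (t + 1) u k *: falling_poly R k) =
    \sum_(k < n.+2)
      (if (k : nat) is j.+1 then meixner_coef n (t + 1) u j else 0)
        *: falling_poly R k
    + \sum_(k < n.+2)
      (k%:R * meixner_coef n (t + 1) u k) *: falling_poly R k.
  rewrite [X in _ = X + _]big_ord_recl /= scale0r add0r.
  rewrite [X in _ = _ + X]big_ord_recr /= {4}/meixner_coef bin_small //.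
  rewrite !mul0r mulr0 scale0r addr0 mulr_sumr -big_split; apply: eq_bigr => k _ /=.
  by rewrite -scalerAr falling_polyS scalerDr scalerA [_ * k%:R]mulrC.
rewrite mulrBl mulX !widen mul_polyC !scaler_sumr -!sumrN -!big_split.
apply: eq_bigr => k _ /=; rewrite meixner_coef_rec !scalerA -!scaleNr -!scalerDl.
by congr (_ *: _); case: k => -[|k] _ /=; ring.
Qed.

(** * Degree and leading coefficient *)

Lemma falling_poly_monic (R : nzRingType) k : falling_poly R k \is monic.
Proof. exact: monic_prod_XsubC. Qed.

Lemma size_falling_poly (R : nzRingType) k : size (falling_poly R k) = k.+1.
Proof. by rewrite size_prod_XsubC /index_enum -enumT size_enum_ord. Qed.

Lemma meixner_monic (R : realType) (n : nat) (t w : R) :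
  0 < t -> 0 < w -> w < 1 ->
  size (meixner n t w) = n.+1 /\ meixner n t w \is monic.
Proof.
move=> t_gt0 w_gt0 w_lt1; rewrite meixner_falling // big_ord_recr /=.
rewrite {2 4}/meixner_coef subnn binn /poch big_ord0 !mulr1 scale1r.
set s := \sum_(_ < _) _.
have lt_s : (size s < size (falling_poly R n))%N.
  rewrite size_falling_poly ltnS (leq_trans (size_sum _ _ _)) //.
  apply/bigmax_leqP => i _; rewrite (leq_trans (size_scale_leq _ _)) //.
  by rewrite size_falling_poly.
rewrite addrC size_polyDl // size_falling_poly; split=> //.
by rewrite monicE lead_coefDl // -monicE falling_poly_monic.
Qed.

(** * Sorted lists of zeros *)

Lemma zeros_of_nth (R : realType) (p : {poly R}) s i :
  zeros_of p s -> (i < size s)%N -> p.[s`_i] = 0.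
Proof. by case=> _ _ rs lt_is; apply/eqP; rewrite -/(root _ _) rs mem_nth. Qed.

Lemma zeros_of_uniq (R : realType) (p : {poly R}) s s' :
  zeros_of p s -> zeros_of p s' -> s = s'.
Proof.
move=> [_ so_s rs] [_ so_s' rs']; apply: lt_sorted_eq => // x.
by rewrite -rs rs'.
Qed.

Lemma zeros_of_le_nth (R : realType) (p : {poly R}) s i j :
  zeros_of p s -> (i <= j)%N -> (j < size s)%N -> s`_i <= s`_j.
Proof.
case=> _ so_s _ le_ij lt_js; rewrite (lt_sorted_leq_nth 0 so_s) // inE.
exact: leq_ltn_trans lt_js.
Qed.

(** A root outside [s] would be one more than the degree allows. *)
Lemma zeros_of_sorted_roots (R : realType) (p : {poly R}) s :
  size p = (size s).+1 -> sorted <%R s ->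
  (forall i, (i < size s)%N -> p.[s`_i] = 0) -> zeros_of p s.
Proof.
move=> sz_p so_s rs; split=> // x; have us := lt_sorted_uniq so_s.
have all_s : all (root p) s.
  by apply/(all_nthP 0) => i lt_is; rewrite /root rs.
apply/idP/idP => [rx|/(allP all_s)//]; apply/negPn/negP => xNs.
have p0 : p != 0 by rewrite -size_poly_eq0 sz_p.
have := max_poly_roots p0 (rs := x :: s); rewrite /= rx all_s xNs us sz_p.
by rewrite ltnn => /(_ isT isT).
Qed.

(** * Locating zeros by sign changes *)

(** Each gap between neighbours of [a] contains a zero by the intermediate value theorem, and the
    degree leaves room for no more. *)
Lemma zeros_of_alternating (R : realType) (p : {poly R}) (a : seq R) n :
  size a = n.+1 -> size p = n.+1 -> sorted <%R a ->
  (forall i, (i <= n)%N -> 0 < (-1) ^+ (n - i) * p.[a`_i]) ->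
  exists s, [/\ zeros_of p s, size s = n
    & forall i, (i < n)%N -> a`_i < s`_i /\ s`_i < a`_i.+1].
Proof.
move=> sz_a sz_p so_a alt.
have le_a i : (i < n)%N -> a`_i < a`_i.+1.
  by move=> lt_in; move/(sortedP 0): so_a; apply; rewrite sz_a.
have root_i (i : 'I_n) : {x | (a`_i < x < a`_i.+1) && root p x}.
  have [||x itv_x rx] := @poly_ivtoo R p a`_i a`_i.+1; first exact/ltW/le_a.
    have := alt i.+1 (ltn_ord i); have := alt i (ltnW (ltn_ord i)).
    rewrite -(subnSK (ltn_ord i)) exprS mulN1r mulNr -signr_odd.
    by case: (odd _); rewrite ?expr0 ?expr1; nra.
  by exists x; rewrite rx andbT; move: itv_x; rewrite in_itv.
pose s := [seq sval (root_i i) | i <- enum 'I_n].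
have sz_s : size s = n by rewrite size_map size_enum_ord.
have nth_s i : (i < n)%N -> [/\ a`_i < s`_i, s`_i < a`_i.+1 & p.[s`_i] = 0].
  move=> lt_in; rewrite (nth_map (Ordinal lt_in)) ?size_enum_ord //.
  case: (root_i _) => x /=; rewrite nth_enum_ord //.
  by case/andP => /andP[-> ->] /rootP ->.
exists s; split=> // [|i /nth_s[]//].
apply: zeros_of_sorted_roots => [||i]; rewrite ?sz_s //; last by case/nth_s.
apply/(sortedP 0) => i; rewrite sz_s => lt_in.
by have [_ /lt_trans h _] := nth_s i (ltnW lt_in); have [/h] := nth_s _ lt_in.
Qed.

Lemma monic_gt0_above (R : realType) (p : {poly R}) (b : R) :
  p \is monic -> exists2 x, b < x & 0 < p.[x].
Proof.
move=> /monicP lc1; have [|x0 px] := @poly_pinfty_gt_lc R p; first by rewrite lc1.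
exists (Num.max (b + 1) x0); first by rewrite lt_max ltrDl ltr01.
by apply: lt_le_trans (px _ _); rewrite ?lc1 // le_max lexx orbT.
Qed.

Lemma monic_sign_below (R : realType) (p : {poly R}) (b : R) :
  p \is monic -> exists2 x, x < b & 0 < (-1) ^+ (size p).-1 * p.[x].
Proof.
move=> mp; have p0 := monic_neq0 mp.
(* Left of minus the Cauchy bound, p has the sign (-1)^deg p of its leading term; the minimum with b
   - 1 puts the point below b. *)
exists (Num.min (b - 1) (- cauchy_bound p)).
  by rewrite gt_min ltrBlDr ltrDl ltr01.
set x := Num.min _ _.
have := @sgp_minftyP R _ _ (le_cauchy_bound p0) x.
rewrite in_itv /= ge_min lexx orbT => /(_ isT).
rewrite /sgp_minfty (monicP mp) mulr1 => e.
by rewrite -sgr_gt0 sgrM e -sgrM -expr2 sqrr_sign sgr1 ltr01.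
Qed.

(* A point [x] with exactly [i] zeros of [p] on its left. *)
Lemma monic_sign_gap (R : realType) (p : {poly R}) s (x : R) i :
  zeros_of p s -> p \is monic -> (i <= size s)%N ->
  ((0 < i)%N -> s`_i.-1 < x) -> ((i < size s)%N -> x < s`_i) ->
  0 < (-1) ^+ (size s - i) * p.[x].
Proof.
move=> zs mp le_is lo hi; have [sz_p so_s rs] := zs.
have all_s : all (root p) s by apply/allP => y; rewrite rs.
have us : poly.uniq_roots s by rewrite uniq_rootsE lt_sorted_uniq.
rewrite (all_roots_prod_XsubC sz_p all_s us) (monicP mp) scale1r.
(* At x the first i linear factors are positive and the other [size s - i] are negative. *)
rewrite -{2}(cat_take_drop i s) big_cat /= hornerM mulrCA !horner_prod.
apply: mulr_gt0.
  rewrite big_seq; apply: prodr_gt0 => y /(nthP 0)[j].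
  rewrite size_takel // => lt_ji <-; rewrite nth_take // hornerXsubC subr_gt0.
  apply: le_lt_trans (lo (leq_ltn_trans _ lt_ji)) => //.
  by apply: (zeros_of_le_nth zs); lia.
have: all (> x) (drop i s).
  apply/(all_nthP 0) => j; rewrite size_drop nth_drop ltn_subRL => lt_j.
  apply: lt_le_trans (hi (leq_ltn_trans (leq_addr _ _) lt_j)) _.
  exact: (zeros_of_le_nth zs (leq_addr _ _)).
rewrite -size_drop; elim: (drop i s) => [|y r IHr] /=.
  by rewrite big_nil mulr1.
case/andP=> lt_xy /IHr; rewrite big_cons hornerXsubC exprS; nra.
Qed.
(** A point far to the left, where p has sign (-1)^n, supplies the missing sign change. *)
Lemma zeros_of_below (R : realType) (p : {poly R}) (a : seq R) n :
  p \is monic -> size p = n.+1 -> size a = n -> sorted <%R a ->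
  (forall i, (i < n)%N -> 0 < (-1) ^+ (n - i.+1) * p.[a`_i]) ->
  exists s, [/\ zeros_of p s, size s = n, forall i, (i < n)%N -> s`_i < a`_i
    & forall i, (i.+1 < n)%N -> a`_i < s`_i.+1].
Proof.
move=> mp sz_p sz_a so_a alt; have [x lt_x px] := monic_sign_below a`_0 mp.
have [||||s [zs sz_s le_s]] := @zeros_of_alternating R p (x :: a) n => //.
- by rewrite /= sz_a.
- by case: (a) so_a lt_x => //= y r -> ->.
- by case=> [|i] /=; [rewrite subn0 -[n]/(n.+1.-1) -sz_p | apply: alt].
exists s; split=> // i lt_in; first by have [] := le_s i lt_in.
by have [] := le_s _ lt_in.
Qed.

(** The added point lies far to the right, where a monic p is positive. *)
Lemma zeros_of_above (R : realType) (p : {poly R}) (a : seq R) n :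
  p \is monic -> size p = n.+1 -> size a = n -> sorted <%R a ->
  (forall i, (i < n)%N -> 0 < (-1) ^+ (n - i) * p.[a`_i]) ->
  exists s, [/\ zeros_of p s, size s = n, forall i, (i < n)%N -> a`_i < s`_i
    & forall i, (i.+1 < n)%N -> s`_i < a`_i.+1].
Proof.
move=> mp sz_p sz_a so_a alt; have [x lt_x px] := monic_gt0_above (last 0 a) mp.
have [||||s [zs sz_s le_s]] := @zeros_of_alternating R p (rcons a x) n => //.
- by rewrite size_rcons sz_a.
- by case: (a) so_a lt_x => //= y r; rewrite rcons_path => -> ->.
- move=> i; rewrite leq_eqVlt nth_rcons sz_a => /predU1P[->|lt_in].
    by rewrite ltnn eqxx subnn mul1r.
  by rewrite lt_in alt.
exists s; split=> // i lt_in.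
  by have [] := le_s i lt_in; rewrite nth_rcons sz_a lt_in.
by have [] := le_s i (ltnW lt_in); rewrite !nth_rcons sz_a lt_in.
Qed.

(** With the degree one above the number of points, an end point is added on both sides: the right
    one here, the left one in [zeros_of_below]. *)
Lemma zeros_of_around (R : realType) (p : {poly R}) (a : seq R) n :
  p \is monic -> size p = n.+2 -> size a = n -> sorted <%R a ->
  (forall i, (i < n)%N -> 0 < (-1) ^+ (n - i) * p.[a`_i]) ->
  exists s, [/\ zeros_of p s, size s = n.+1, forall i, (i < n)%N -> s`_i < a`_i
    & forall i, (i < n)%N -> a`_i < s`_i.+1].
Proof.
move=> mp sz_p sz_a so_a alt; have [x lt_x px] := monic_gt0_above (last 0 a) mp.
have [|||s [zs sz_s lo hi]] := @zeros_of_below R p (rcons a x) n.+1 mp sz_p.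
- by rewrite size_rcons sz_a.
- by case: (a) so_a lt_x => //= y r; rewrite rcons_path => -> ->.
- move=> i; rewrite ltnS leq_eqVlt nth_rcons sz_a => /predU1P[->|lt_in].
    by rewrite ltnn eqxx subnn mul1r.
  by rewrite lt_in subSS alt.
exists s; split=> // i lt_in.
  by have := lo i (ltnW lt_in); rewrite nth_rcons sz_a lt_in.
by have := hi i lt_in; rewrite nth_rcons sz_a lt_in.
Qed.

(** * Interlacing, signs and three-term recurrences *)

(** The lists in [interlaces] are existential; since a polynomial has only one sorted list of zeros,
    the inequalities transfer to any given lists. *)
Lemma interlaces_nth (R : realType) (f g : {poly R}) xs ys :
  interlaces f g -> zeros_of f xs -> zeros_of g ys ->
  (forall i, (i < size ys)%N -> xs`_i < ys`_i) /\
  (forall i, (i.+1 < size xs)%N -> ys`_i < xs`_i.+1).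
Proof.
move=> [xs' [ys' [zx zy _ lo hi]]] zx' zy'.
by rewrite -(zeros_of_uniq zx zx') -(zeros_of_uniq zy zy').
Qed.

(** Exactly i zeros of g lie to the left of the zero of f with index i. *)
Lemma interlaces_sign (R : realType) (f g : {poly R}) xs ys i :
  interlaces f g -> zeros_of f xs -> zeros_of g ys -> g \is monic ->
  (i < size xs)%N -> (i <= size ys)%N -> 0 < (-1) ^+ (size ys - i) * g.[xs`_i].
Proof.
move=> fg zx zy mg lt_ix le_iy; have [lo hi] := interlaces_nth fg zx zy.
apply: (monic_sign_gap zy) => //; last exact: lo.
by case: i lt_ix {le_iy} => // i /hi.
Qed.

(** At a zero z of p_{m+1} the recurrence reads p_{m+2}(z) = - c_m p_m(z). By induction p_m
    alternates along these zeros, hence so does p_{m+2}, and [zeros_of_around] places its zeros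
    around them. *)
Lemma three_term_interlaces (R : realType) (p : nat -> {poly R}) (b c : nat -> R) :
  (forall m, p m \is monic) -> (forall m, size (p m) = m.+1) ->
  (forall m, 0 < c m) ->
  (forall m, p m.+2 = ('X - (b m)%:P) * p m.+1 - c m *: p m) ->
  forall m, interlaces (p m.+1) (p m).
Proof.
move=> mp sz_p c_gt0 rec; elim=> [|m IHm].
  (* With no points, [zeros_of_around] gives the zero of the linear p_1; the constant p_0 has
     none. *)
  have [|||||s [zs sz_s _ _]] := @zeros_of_around R (p 1%N) [::] 0 => //.
  exists s, [::]; split=> //; rewrite ?sz_s //; last by right.
  split=> [|//|x]; first by rewrite sz_p.
  have := sz_p 0%N => /eqP/size_poly1P[c0 c0N0 ->].
  by rewrite rootC (negPf c0N0).
have [zs [ys [zz zy _ _ _]]] := IHm.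
have sz_z : size zs = m.+1 by case: zz; rewrite sz_p => -[].
have sz_y : size ys = m by case: zy; rewrite sz_p => -[].
have [|||||xs [zx sz_x lo hi]] := @zeros_of_around R (p m.+2) zs m.+1 => //.
- by case: zz.
- move=> i lt_im.
  have := interlaces_sign IHm zz zy (mp m) (i := i).
  rewrite sz_z sz_y => /(_ lt_im lt_im).
  rewrite rec hornerD hornerN hornerM hornerZ (zeros_of_nth zz) ?sz_z //.
  rewrite subSn // exprS; have := c_gt0 m; nra.
by exists xs, zs; split; rewrite ?sz_x ?sz_z //; right.
Qed.

(** The position k of e is recorded because the zeros of p beyond it move up by one index, which
    fixes the signs in the final argument. As e is no root of p, all zeros stay simple. *)
Lemma zeros_of_mul_XsubC (R : realType) (p : {poly R}) s (e : R) :
  zeros_of p s -> ~~ root p e ->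
  exists fs k, [/\ zeros_of (('X - e%:P) * p) fs, size fs = (size s).+1,
    (k <= size s)%N /\ fs`_k = e,
    forall i, (i < k)%N -> fs`_i = s`_i /\ s`_i < e
    & forall i, (k <= i < size s)%N -> fs`_i.+1 = s`_i /\ e < s`_i].
Proof.
move=> zs pe; have [sz_p so_s rs] := zs.
(* Since [s] is sorted, k is the number of zeros below e. *)
pose k := find (>= e) s; have le_k : (k <= size s)%N := find_size _ _.
pose fs := take k s ++ e :: drop k s.
have sz_fs : size fs = (size s).+1.
  by rewrite size_cat /= addnS -size_cat cat_take_drop.
have fsk : fs`_k = e by rewrite nth_cat size_takel // ltnn subnn.
have fs_lo i : (i < k)%N -> fs`_i = s`_i /\ s`_i < e.
  move=> lt_ik; rewrite nth_cat size_takel // lt_ik nth_take //; split=> //.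
  by rewrite ltNge (before_find 0 lt_ik).
have fs_hi i : (k <= i < size s)%N -> fs`_i.+1 = s`_i /\ e < s`_i.
  case/andP=> le_ki lt_is; rewrite nth_cat size_takel // ltnNge leqW //=.
  rewrite subSn //= nth_drop subnKC //; split=> //.
  rewrite lt_neqAle; apply/andP; split.
    by apply: contraNneq pe => ->; rewrite rs mem_nth.
  apply: le_trans (zeros_of_le_nth zs le_ki lt_is).
  by apply: (@nth_find _ 0 (>= e)); rewrite has_find; apply: leq_ltn_trans lt_is.
exists fs, k; split=> //; apply: zeros_of_sorted_roots.
- by rewrite size_monicM ?monicXsubC -?size_poly_eq0 ?size_XsubC ?sz_p ?sz_fs.
- apply/(sortedP 0) => i; rewrite sz_fs ltnS => lt_is.
  case: (ltngtP i.+1 k) => [lt_ik|lt_ki|eq_ik].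
  + have [-> _] := fs_lo _ lt_ik; have [-> _] := fs_lo _ (ltnW lt_ik).
    by move/(sortedP 0): so_s; apply; apply: leq_trans le_k.
  + have [|-> lt_e] := fs_hi i; first by apply/andP.
    move: lt_ki; rewrite ltnS leq_eqVlt => /predU1P[eq_ki|].
      by rewrite -{1}eq_ki fsk.
    case: i lt_is lt_e => // i lt_is _ le_ki.
    have [|-> _] := fs_hi i; first by apply/andP; rewrite (ltnW lt_is).
    by move/(sortedP 0): so_s; apply.
  + by rewrite eq_ik fsk; have [|-> ] := fs_lo i; rewrite -?eq_ik.
move=> i; rewrite sz_fs ltnS => le_is; rewrite hornerM hornerXsubC.
case: (ltngtP i k) => [lt_ik|lt_ki|->]; last by rewrite fsk subrr mul0r.
  have [-> _] := fs_lo i lt_ik.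
  by rewrite (zeros_of_nth zs) ?mulr0 //; apply: leq_trans le_k.
case: i lt_ki le_is => // i le_ki lt_is.
have [|-> _] := fs_hi i; first by apply/andP.
by rewrite (zeros_of_nth zs) ?mulr0.
Qed.

(** * Interlacing of Meixner polynomials *)

Lemma meixner_interlaces_succ (R : realType) (n : nat) (t w : R) :
  0 < t -> 0 < w -> w < 1 ->
  interlaces (meixner n.+1 (t + 1) w) (meixner n (t + 1) w).
Proof.
move=> t_gt0 w_gt0 w_lt1; have t1_gt0 : 0 < t + 1 by lra.
have w1_gt0 : 0 < 1 - w by lra.
(* Substituting M_{m+1}(t) = M_{m+1}(t+1) + a_m M_m(t+1) into the shift relation for M_{m+2}(t+1)
   gives b_m = E_{m+1} + d_m and c_m = d_m a_m. *)
pose d m := (m.+1%:R + t) / (1 - w); pose a m : R := m.+1%:R * (w / (1 - w)).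
apply: (@three_term_interlaces R (fun m => meixner m (t + 1) w)
  (fun m => meixner_E m.+1 t w + d m) (fun m => d m * a m)) => [m|m|m|m].
- by have [] := meixner_monic m t1_gt0 w_gt0 w_lt1.
- by have [] := meixner_monic m t1_gt0 w_gt0 w_lt1.
- by rewrite !mulr_gt0 ?invr_gt0 ?ltr0Sn // addr_gt0 ?ltr0Sn.
rewrite meixner_shift_rec // (@meixner_contiguous R m t) // -/(d m) -/(a m).
by rewrite [(_ + d m)%:P]polyCD -!mul_polyC [(d m * _)%:P]polyCM; ring.
Qed.

(** At a zero z of M_n(.; t+1), [meixner_contiguous] leaves a positive multiple of M_{n-1}(z; t+1),
    which alternates along these zeros and is positive at the largest, so [zeros_of_below]
    applies. *)
Lemma meixner_interlaces_shift (R : realType) (n : nat) (t w : R) :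
  0 < t -> 0 < w -> w < 1 -> interlaces (meixner n t w) (meixner n (t + 1) w).
Proof.
move=> t_gt0 w_gt0 w_lt1; have t1_gt0 : 0 < t + 1 by lra.
have [sz_P mP] := meixner_monic n t_gt0 w_gt0 w_lt1.
have [_ [zs [_ zz _ _ _]]] := meixner_interlaces_succ n t_gt0 w_gt0 w_lt1.
have sz_z : size zs = n.
  by case: zz; have [-> _] := meixner_monic n t1_gt0 w_gt0 w_lt1; case.
have [||ys [zy sz_y lo hi]] := zeros_of_below mP sz_P sz_z; first by case: zz.
  case: n zz sz_z {sz_P mP} => // n zz sz_z i lt_in; rewrite subSS.
  have I := meixner_interlaces_succ n t_gt0 w_gt0 w_lt1.
  have [_ [us [_ zu _ _ _]]] := I.
  have [sz_p mp] := meixner_monic n t1_gt0 w_gt0 w_lt1.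
  have sz_u : size us = n by case: zu; rewrite sz_p; case.
  have := interlaces_sign I zz zu mp (i := i).
  rewrite sz_z sz_u => /(_ lt_in lt_in).
  rewrite (@meixner_contiguous R n t) // hornerD (zeros_of_nth zz) ?sz_z //.
  rewrite add0r (hornerZ _ (meixner n (t + 1) w)).
  move=> sgn; rewrite mulrCA; apply: mulr_gt0 => //.
  by rewrite mulr_gt0 ?ltr0Sn // divr_gt0 // subr_gt0.
exists ys, zs; split; rewrite ?sz_y ?sz_z //; by left.
Qed.

(** If E is a zero of P, as for n = 1 and t = 2w, then (x - E) P has a double zero and cannot
    interlace with Q; hence the condition on that claim alone. *)
Theorem corollary3p2 (R : realType) (n : nat) (t w : R)
    (t_gt0 : 0 < t) (w_gt0 : 0 < w) (w_lt1 : w < 1) :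
  exists xs : seq R,
    [/\ zeros_of (meixner n.+1 (t + 1) w) xs,
        meixner_E n t w < xs`_n,
        ~~ root (meixner n t w) (meixner_E n t w) ->
          interlaces (('X - (meixner_E n t w)%:P) * meixner n t w)
                     (meixner n.+1 (t + 1) w)
      & interlaces (meixner n.+1 (t + 1) w) (meixner n t w)
        <-> meixner_E n t w < xs`_0].
Proof.
have t1_gt0 : 0 < t + 1 by lra.
have QpI := meixner_interlaces_succ n t_gt0 w_gt0 w_lt1.
have PpI := meixner_interlaces_shift n t_gt0 w_gt0 w_lt1.
have rec := meixner_shift_rec n t_gt0 w_gt0 w_lt1.
have [] := meixner_monic n t_gt0 w_gt0 w_lt1.
have [] := meixner_monic n t1_gt0 w_gt0 w_lt1.
have [] := meixner_monic n.+1 t1_gt0 w_gt0 w_lt1.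
have d_gt0 : 0 < (n%:R + t) / (1 - w).
  by rewrite divr_gt0 ?subr_gt0 // ltr_wpDl.
move: QpI PpI rec d_gt0; set Q := meixner n.+1 _ _; set p := meixner n (t + 1) w.
set P := meixner n t w; set E := meixner_E n t w; move: (_ / _) => d.
move=> QpI PpI rec d_gt0 sz_Q mQ sz_p mp sz_P mP.
have [xs [zs [zx zz _ _ hiz]]] := QpI; have [ys [_ [zy _ _ _ _]]] := PpI.
have sz_x : size xs = n.+1 by case: zx; rewrite sz_Q; case.
have sz_y : size ys = n by case: zy; rewrite sz_P; case.
have sz_z : size zs = n by case: zz; rewrite sz_p; case.
have [loy hiy] := interlaces_nth PpI zy zz.
have Qy i : (i < n)%N -> Q.[ys`_i] = (ys`_i - E) * p.[ys`_i].
  move=> lt_in; rewrite rec hornerD hornerN (hornerZ d) (zeros_of_nth zy) ?sz_y //.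
  by rewrite mulr0 subr0 hornerM hornerXsubC.
have QE : Q.[E] = - (d * P.[E]).
  by rewrite rec hornerD hornerN (hornerZ d) hornerM hornerXsubC subrr mul0r add0r.
have py i : (i < n)%N -> 0 < (-1) ^+ (n - i) * p.[ys`_i].
  move=> lt_in; have := interlaces_sign PpI zy zz mp (i := i).
  by rewrite sz_y sz_z => /(_ lt_in (ltnW lt_in)).
(* E is kept with its index k, because the closing equivalence comes down to k = 0. *)
have key : ~~ root P E -> exists fs k,
  [/\ zeros_of (('X - E%:P) * P) fs, size fs = n.+1 & [/\ (k <= n)%N, fs`_k = E,
    forall i, (i < k)%N -> fs`_i = ys`_i /\ ys`_i < E,
    forall i, (k <= i < n)%N -> fs`_i.+1 = ys`_i /\ E < ys`_i &
    (forall i, (i < n.+1)%N -> fs`_i < xs`_i) /\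
    (forall i, (i.+1 < n.+1)%N -> xs`_i < fs`_i.+1)]].
  move=> PE; have [fs [k []]] := zeros_of_mul_XsubC zy PE.
  rewrite sz_y => zf sz_f [le_k fk] f_lo f_hi.
  exists fs, k; split=> //; split=> //.
  have [|i lt_in|s [zs' _ lo hi]] := zeros_of_above mQ sz_Q sz_f; first by case: zf.
    (* Before index k the factor y_i - E is negative and adds one sign to that of p; after it the
       factor is positive and the index shift makes up for it; at k, Q(E) = - d P(E) and k zeros of
       P lie below E. *)
    case: (ltngtP i k) => [lt_ik|lt_ki|->].
    - have [-> lt_E] := f_lo _ lt_ik.
      have lt_i : (i < n)%N by apply: leq_trans le_k.
      by rewrite Qy // subSn ?exprS; [have := py i lt_i; nra | apply: ltnW].
    - case: i lt_ki lt_in => // i le_ki lt_in.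
      have [|-> lt_E] := f_hi i; first by apply/andP.
      by rewrite Qy // subSS mulrCA mulr_gt0 ?subr_gt0 ?py.
    rewrite fk QE subSn // exprS.
    have : 0 < (-1) ^+ (n - k) * P.[E].
      have := monic_sign_gap zy mP (x := E) (i := k); rewrite sz_y; apply=> //.
        case: (k) f_lo => // j f_lo _; by have [] := f_lo j (ltnSn _).
      by move=> lt_kn; have [] := f_hi k; rewrite ?leqnn.
    by move=> sgn; rewrite mulN1r mulrNN mulrCA mulr_gt0.
  by rewrite -(zeros_of_uniq zs' zx).
exists xs; split=> //.
- have [PE|/key[fs [k [zf sz_f [le_k <- _ _ [lo _]]]]]] := boolP (root P E); last first.
    apply: le_lt_trans (lo n (ltnSn n)).
    by apply: (zeros_of_le_nth zf); rewrite ?sz_f.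
  (* Here E = y_i <= y_{n-1} < z_{n-1} < x_n, with y, z, x the zeros of P, p, Q. *)
  have := PE; have [_ _ ->] := zy => /(nthP 0)[i]; rewrite sz_y => lt_in <-.
  have n_gt0 : (0 < n)%N by apply: leq_ltn_trans lt_in.
  apply: le_lt_trans (zeros_of_le_nth zy (j := n.-1) _ _) _; rewrite ?sz_y; try lia.
  have := loy n.-1; rewrite sz_z => /(_ _)/lt_trans; apply; first lia.
  by have := hiz n.-1; rewrite sz_x prednK //; apply.
- case/key=> fs [k [zf sz_f [_ _ _ _ [lo hi]]]].
  exists fs, xs; split=> //; rewrite ?sz_f ?sz_x //; by left.
split=> [QPI|lt_Ex].
- have PE_k0 : ~~ root P E /\ forall i, (i < n)%N -> E < ys`_i.
    case: (posnP n) => [n0|n_gt0].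
      split=> [|i]; last by rewrite n0.
      have [_ _ ->] := zy; by rewrite (size0nil (etrans sz_y n0)).
    (* The least zero y_0 of P lies between the first two zeros of Q, so Q(y_0) has sign (-1)^n, as
       has p(y_0); hence y_0 - E > 0. *)
    have lt_E : E < ys`_0.
      have [loq hiq] := interlaces_nth QPI zx zy.
      have := monic_sign_gap zx mQ (x := ys`_0) (i := 1); rewrite sz_x => /(_ isT).
      have /[swap]/[apply] : (0 < 1)%N -> xs`_0 < ys`_0 by rewrite loq ?sz_y.
      have /[swap]/[apply] : (1 < n.+1)%N -> ys`_0 < xs`_1 by rewrite -sz_x; exact: hiq.
      rewrite subSS Qy // mulrCA; have := py 0%N n_gt0.
      by move=> /pmulr_lgt0 ->; rewrite subr_gt0.
    have lt_Ei i : (i < n)%N -> E < ys`_i.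
      move=> lt_in; apply: lt_le_trans lt_E (zeros_of_le_nth zy _ _) => //.
      by rewrite sz_y.
    split=> //; have [_ _ ->] := zy; apply/(nthP 0) => -[i].
    by rewrite sz_y => /lt_Ei; rewrite lt_neqAle => /andP[/eqP nE _ /esym].
  have [/key[fs [k [_ _ [le_k fk f_lo _ [lo _]]]]] lt_Ei] := PE_k0.
  (* A positive k would put a zero of P below E. *)
  suff k0 : k = 0%N by rewrite -fk k0 lo.
  case: k le_k {fk} f_lo => // k lt_kn f_lo.
  have [_ lt_yE] := f_lo k (ltnSn k).
  by have := lt_Ei k lt_kn; rewrite ltNge ltW.
have PE : ~~ root P E.
  (* P(E) = 0 forces Q(E) = 0, so E would be a zero of Q below its least zero. *)
  apply/negP => /rootP PE; have : root Q E by rewrite /root QE PE mulr0 oppr0.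
  have [_ _ ->] := zx => /(nthP 0)[i lt_i e]; move: lt_Ex; rewrite -e.
  by rewrite ltNge (zeros_of_le_nth zx).
have [fs [k [zf sz_f [le_k fk f_lo f_hi [lo hi]]]]] := key PE.
(* If k > 0, then E < x_0 < fs_1 <= fs_k = E. *)
have k0 : k = 0%N.
  case: k le_k fk {f_lo f_hi} => // k lt_kn fk.
  have := lt_trans lt_Ex (hi 0%N _).
  rewrite ltnS (leq_ltn_trans _ lt_kn) // => /(_ isT).
  by rewrite -fk ltNge (zeros_of_le_nth zf) ?sz_f.
(* With k = 0 the zeros of P are fs_1, ..., fs_n, so [hi] and [lo] give x_i < y_i < x_{i+1}. *)
exists xs, ys; split=> //; rewrite ?sz_x ?sz_y; first by right.
  move=> i lt_in; have [|<- _] := f_hi i; first by rewrite k0.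
  exact: hi.
move=> i lt_in; have [|<- _] := f_hi i; first by rewrite k0.
exact: lo.
Qed.
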